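(* Let $\mathbb{F}$ be a field of characteristic $0$, let $\Gamma$ be the free group generated by $X=\{x_1,\dots,x_n\}$, and fix a total order on $\Gamma$ compatible with the group structure. (1) Let a (possibly infinite) group $G$ act on the skew-field of Malcev–Neumann series $\mathbb{F}((\Gamma))$, the action being given by an action of $G$ on $\mathbb{F}$ and the trivial action on $\Gamma$, i.e. $g\cdot\sum_{\omega}a_\omega\omega=\sum_\omega (g\cdot a_\omega)\omega$. Then $\mathbb{F}((\Gamma))^G=\mathbb{F}^G((\Gamma))$. (2) Let $\mathbb{K}\subset\mathbb{F}$ be a subfield. Then, inside $\mathbb{F}((\Gamma))$, $\mathbb{K}((\Gamma))\cap \mathbb{F}(\!\langle \Gamma\rangle\!)=\mathbb{K}(\!\langle\Gamma\rangle\!)$. (3) Let a (possibly infinite) group $G$ act on the free skew-field $\mathbb{F}(\!\langle\Gamma\rangle\!)$, the action being given by an action of $G$ on $\mathbb{F}$ and the trivial action on $\Gamma$. Then $\mathbb{F}(\!\langle\Gamma\rangle\!)^G=\mathbb{F}^G(\!\langle\Gamma\rangle\!)$.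
   Context: Groups act on fields by field automorphisms and on skew-fields by ring automorphisms; a superscript $G$ denotes the set of elements fixed by $G$. Malcev–Neumann series: for a field $\mathbb{F}$ and a totally ordered free group $(\Gamma,\le)$ with order compatible with the group structure, $\mathbb{F}((\Gamma))$ is the set of formal series $\sum_{\omega\in\Gamma}a_\omega\omega$ (functions $\Gamma\to\mathbb{F}$) whose support $\{\omega: a_\omega\ne 0\}$ is well ordered, with pointwise addition and Cauchy product $ab=\sum_{\omega}\left(\sum_{\alpha\beta=\omega}a_\alpha b_\beta\right)\omega$; it is a skew-field. For a subfield $\mathbb{K}$ of $\mathbb{F}$, $\mathbb{K}((\Gamma))$ is regarded as the subset of $\mathbb{F}((\Gamma))$ of series with coefficients in $\mathbb{K}$, using the same order. The free skew-field $\mathbb{F}(\!\langle\Gamma\rangle\!)=\mathbb{F}(\!\langle x_1,\dots,x_n\rangle\!)$ (noncommutative rational functions in $x_1,\dots,x_n$) is the universal skew-field of fractions of the free algebra $\mathbb{F}\langle x_1,\dots,x_n\rangle$, equivalently of the group algebra $\mathbb{F}\Gamma$. It is identified with the rational closure of $\mathbb{F}\langle x_1,\dots,x_n\rangle$ in $\mathbb{F}((\Gamma))$, i.e. the smallest subring of $\mathbb{F}((\Gamma))$ containing $\mathbb{F}\langle x_1,\dots,x_n\rangle$ and closed under inverses of nonzero elements. *)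

(* Defs.v *)
From HB Require Import structures.
From mathcomp Require Import wochoice finmap.
From mathcomp Require Import all_boot all_order all_algebra.
From mathcomp Require Import all_classical.
Set Implicit Arguments.
Unset Strict Implicit.
Unset Printing Implicit Defensive.

Import Order.TTheory GRing.Theory.
Local Open Scope classical_set_scope.
Local Open Scope ring_scope.

HB.mixin Record isOrderedGroup (d : Order.disp_t) G
    of Group G & Order.Total d G := {
  le_mulg2l : forall z u v : G, (u <= v)%O -> (z * u <= z * v)%g%O;
  le_mulg2r : forall z u v : G, (u <= v)%O -> (u * z <= v * z)%g%O
}.

#[short(type="orderedGroupType")]
HB.structure Definition OrderedGroup (d : Order.disp_t) :=
  { G of Group G & Order.Total d G & isOrderedGroup d G }.

Definition freely_generates (G : groupType) (n : nat) (x : 'I_n -> G) : Prop :=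
  forall (H : groupType) (h : 'I_n -> H),
    exists! f : G -> H,
      {morph f : u v / (u * v)%g} /\ (forall i, f (x i) = h i).

Section WellOrdered.
Variables (d : Order.disp_t) (G : orderedGroupType d).
Implicit Types (A B C : set G) (u v w : G).

Lemma le_mulg2lE z u v : (z * u <= z * v)%g%O = (u <= v)%O.
Proof.
apply/idP/idP => [|/le_mulg2l]; last exact.
by move/(le_mulg2l z^-1%g); rewrite !mulKg.
Qed.

Lemma lt_mulg2lE z u v : (z * u < z * v)%g%O = (u < v)%O.
Proof. by rewrite !ltNge; congr (~~ _); exact: le_mulg2lE. Qed.

Lemma le_mulg2rE z u v : (u * z <= v * z)%g%O = (u <= v)%O.
Proof.
apply/idP/idP => [|/le_mulg2r]; last exact.
by move/(le_mulg2r z^-1%g); rewrite !mulgK.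
Qed.

Lemma lt_mulg2rE z u v : (u * z < v * z)%g%O = (u < v)%O.
Proof. by rewrite !ltNge; congr (~~ _); exact: le_mulg2rE. Qed.

Lemma le_invgE u v : (v^-1 <= u^-1)%g%O = (u <= v)%O.
Proof.
by rewrite -(le_mulg2lE u v^-1%g) mulgV -(le_mulg2rE v (u * v^-1)%g) mulgVK mul1g.
Qed.

Definition has_min A := exists2 m, A m & forall w, A w -> (m <= w)%O.

Definition wo A := forall B, B `<=` A -> B !=set0 -> has_min B.

Lemma wo_chainP (X : {pred G}) : wo_chain <=%O X <-> wo [set` X].
Proof.
split=> [woX B BX [w Bw]|woX X' X'X [w X'w]].
  have [v||m [[Bm mB] _]] := woX [in B].
  - by rewrite inE => /BX.
  - by exists w; exact/mem_set.
  by exists m => [|v Bv]; [exact/set_mem | apply: mB; exact/mem_set].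
have [v||m Xm mX] := woX [set` X'].
- by move=> /= /X'X.
- by exists w.
exists m; split=> [|m' [Xm' m'X]]; first by split.
by apply/le_anti; rewrite mX//= m'X.
Qed.

Lemma sub_wo A B : A `<=` B -> wo B -> wo A.
Proof. by move=> AB woB C CA; apply: woB; apply: subset_trans AB. Qed.

Lemma setU_wo A B : wo A -> wo B -> wo (A `|` B).
Proof.
move=> woA woB C CAB [c Cc].
have [[a [Ca Aa]]|CA] := pselect (exists a, C a /\ A a); last first.
  apply: woB; last by exists c.
  by move=> w Cw; have [Aw|//] := CAB _ Cw; case: CA; exists w.
have [||a0 [Ca0 Aa0] a0P] := woA (C `&` A); [by move=> ? []|by exists a|].
have [[b [Cb Bb]]|CB] := pselect (exists b, C b /\ B b); last first.
  exists a0 => // w Cw; apply: a0P; split=> //.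
  by have [//|Bw] := CAB _ Cw; case: CB; exists w.
have [||b0 [Cb0 Bb0] b0P] := woB (C `&` B); [by move=> ? []|by exists b|].
have [ab|/ltW ba] := leP a0 b0.
  exists a0 => // w Cw; have [Aw|Bw] := CAB _ Cw; first exact: a0P.
  by apply: le_trans ab _; exact: b0P.
exists b0 => // w Cw; have [Aw|Bw] := CAB _ Cw; last exact: b0P.
by apply: le_trans ba _; exact: a0P.
Qed.

Lemma set1_wo u : wo [set u].
Proof. by move=> C Cu [w Cw]; exists w => // v /Cu ->; rewrite (Cu _ Cw). Qed.

Definition mulset A B := [set w | exists u v, [/\ A u, B v & w = (u * v)%g]].

Lemma mulset_wo A B : wo A -> wo B -> wo (mulset A B).
Proof.
move=> woA woB.
pose P b0 := forall C, C !=set0 ->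
    C `<=` mulset A [set b | B b /\ (b < b0)%O] -> has_min C.
have step B' C : B' `<=` B -> C `<=` mulset A B' -> C !=set0 ->
    (forall b, B' b -> P b) -> has_min C.
  move=> B'B CAB [c Cc] IH.
  pose A' := [set u | A u /\ exists2 v, B' v & C (u * v)%g].
  have [||u0 [Au0 [v1 Bv1 Cv1]] u0P] := woA A'.
  - by move=> ? [].
  - have [u [v [Au Bv cE]]] := CAB _ Cc.
    by exists u; split=> //; exists v => //; rewrite -cE.
  have [||v0 [Bv0 Cv0] v0P] := woB [set v | B' v /\ C (u0 * v)%g].
  - by move=> ? [/B'B].
  - by exists v1.
  have [[c1 [Cc1 lc1]]|C1] := pselect (exists c1, C c1 /\ (c1 < u0 * v0)%g%O);
      last first.
    exists (u0 * v0)%g => // w Cw; rewrite leNgt; apply/negP => lw.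
    by case: C1; exists w.
  have [||m [Cm lm] mP] := IH v0 Bv0 [set w | C w /\ (w < u0 * v0)%g%O].
  - by exists c1.
  - move=> w [Cw lw]; have [u [v [Au Bv wE]]] := CAB _ Cw.
    exists u, v; split=> //; split; first exact: B'B.
    have u0u : (u0 <= u)%O by apply: u0P; split=> //; exists v; rewrite -?wE.
    rewrite -(lt_mulg2lE u0); apply: le_lt_trans lw; rewrite wE.
    by rewrite le_mulg2rE.
  exists m => // w Cw; have [lw|] := ltP w (u0 * v0)%g; first exact: mP.
  exact: le_trans (ltW lm).
have PB b : B b -> P b.
  move=> Bb; apply: contrapT => nPb.
  have [||b0 [Bb0 nPb0] b0P] := woB [set b | B b /\ ~ P b].
  - by move=> ? [].
  - by exists b.
  apply: nPb0 => C C0 CS.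
  apply: (step [set b | B b /\ (b < b0)%O] C) => //; first by move=> ? [].
  move=> b' [Bb' lb']; apply: contrapT => nPb'.
  by have := b0P _ (conj Bb' nPb'); rewrite leNgt lb'.
by move=> C CAB C0; apply: (step B).
Qed.

Lemma finite_convolution A B w : wo A -> wo B ->
  finite_set [set u | A u /\ B (u^-1 * w)%g].
Proof.
move=> woA woB; set S := [set u | _].
have maxS C : C `<=` S -> C !=set0 -> exists2 m, C m & forall u, C u -> (u <= m)%O.
  move=> CS [c Cc].
  have [||m [u Cu um] mP] := woB [set (u^-1 * w)%g | u in C].
  - by move=> _ [u Cu <-]; have [] := CS _ Cu.
  - by exists (c^-1 * w)%g; exists c.
  exists u => // v Cv; rewrite -le_invgE -(le_mulg2rE w) um.
  by apply: mP; exists v.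
have minS C : C `<=` S -> C !=set0 -> has_min C.
  by move=> CS; apply: woA => u /CS [].
have [->|/set0P S0] := eqVneq S set0; first exact: finite_set0.
pose P := [set u | S u /\ finite_set [set v | S v /\ (v <= u)%O]].
have [||m [Sm fm] mP] := maxS P; [by move=> ? []| |].
  have [|//|u Su uP] := minS S; first by [].
  exists u; split=> //; apply: sub_finite_set (finite_set1 u) => v [Sv vu].
  by apply/le_anti; rewrite vu uP.
have [Sgt|Sle] := pselect (exists v, S v /\ (m < v)%O).
  have [||v [Sv mv] vP] := minS [set v | S v /\ (m < v)%O]; first by move=> ? [].
    by [].
  have : P v.
    split=> //; apply: sub_finite_set (_ : finite_set ([set u | S u /\ (u <= m)%O] `|` [set v])).
      move=> u [Su uv]; have [um|mu] := leP u m; [by left|right].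
      by apply/le_anti; rewrite uv vP.
    by rewrite finite_setU; split=> //; exact: finite_set1.
  by move=> /mP; rewrite leNgt mv.
apply: sub_finite_set fm => u Su; split=> //; rewrite leNgt; apply/negP => mu.
by apply: Sle; exists u.
Qed.
End WellOrdered.

(* Malcev-Neumann series: the support is a well-ordered chain. *)
Record mnseries (F : fieldType) d (G : orderedGroupType d) := MNSeries {
  mncoef :> G -> F;
  mncoef_wo : wo_chain <=%O [pred w | mncoef w != 0]
}.

Section Series.
Variables (F : fieldType) (d : Order.disp_t) (G : orderedGroupType d).
Local Notation series := (mnseries F G).
Implicit Types (a b c : series) (u v w : G).

Definition supp (f : G -> F) : set G := [set w | f w != 0].

Lemma supp_wo a : wo (supp a).
Proof. exact/wo_chainP/mncoef_wo. Qed.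
Arguments supp_wo a : clear implicits.

Lemma mn_ext a b : a =1 b -> a = b.
Proof.
case: a b => [f fP] [g gP] /= /funext fg.
by move: fP gP; rewrite fg => fP gP; rewrite (Prop_irrelevance fP gP).
Qed.

HB.instance Definition _ := gen_eqMixin series.
HB.instance Definition _ := gen_choiceMixin series.

Lemma mk_wo (f : G -> F) (A : set G) :
  wo A -> supp f `<=` A -> wo_chain <=%O [pred w | f w != 0].
Proof. by move=> woA fA; apply/wo_chainP; exact: sub_wo woA. Qed.

Lemma mn_mono_wo (c : F) w :
  wo_chain <=%O [pred u | (if u == w then c else 0) != 0].
Proof.
apply: (mk_wo (@set1_wo _ _ w) (f := fun u => if u == w then c else 0)) => u; rewrite /supp /=.
by case: ifPn => [/eqP//|]; rewrite eqxx.
Qed.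
Arguments mn_mono_wo : clear implicits.
Definition mn_mono (c : F) w : series := MNSeries (mn_mono_wo c w).

Lemma mn_zero_wo : wo_chain <=%O [pred u : G | (0 : F) != 0].
Proof.
by apply: (mk_wo (@set1_wo _ _ 1%g) (f := fun=> 0)) => u; rewrite /supp /= eqxx.
Qed.
Definition mn_zero : series := MNSeries (@mn_zero_wo).

Lemma mn_opp_wo a : wo_chain <=%O [pred w | - a w != 0].
Proof. by apply: (mk_wo (supp_wo a) (f := fun u => - a u)) => u; rewrite /supp /= oppr_eq0. Qed.
Arguments mn_opp_wo : clear implicits.
Definition mn_opp a : series := MNSeries (mn_opp_wo a).

Lemma mn_add_wo a b : wo_chain <=%O [pred w | a w + b w != 0].
Proof.
apply: (mk_wo (setU_wo (supp_wo a) (supp_wo b)) (f := fun u => a u + b u)) => u; rewrite /supp /=.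
have [->|] := eqVneq (a u) 0; last by left.
by rewrite add0r; right.
Qed.
Arguments mn_add_wo : clear implicits.
Definition mn_add a b : series := MNSeries (mn_add_wo a b).

Lemma mn_addA : associative mn_add.
Proof. by move=> a b c; apply: mn_ext => w /=; rewrite addrA. Qed.
Lemma mn_addC : commutative mn_add.
Proof. by move=> a b; apply: mn_ext => w /=; rewrite addrC. Qed.
Lemma mn_add0 : left_id mn_zero mn_add.
Proof. by move=> a; apply: mn_ext => w /=; rewrite add0r. Qed.
Lemma mn_addN : left_inverse mn_zero mn_opp mn_add.
Proof. by move=> a; apply: mn_ext => w /=; rewrite addNr. Qed.

HB.instance Definition _ :=
  GRing.isZmodule.Build series mn_addA mn_addC mn_add0 mn_addN.

(* The sum has finitely many nonzero terms when f and g have well-ordered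
   support, by finite_convolution. *)
Definition cauchy (f g : G -> F) w : F :=
  \sum_(p \in [set p : G * G | (p.1 * p.2)%g = w]) f p.1 * g p.2.

Lemma cauchyE (f g : G -> F) w (r : seq G) : uniq r ->
  (forall u, f u != 0 -> g (u^-1 * w)%g != 0 -> u \in r) ->
  cauchy f g w = \sum_(u <- r) f u * g (u^-1 * w)%g.
Proof.
move=> ur rP; rewrite /cauchy (fsbigE [seq (u, u^-1 * w)%g | u <- r]).
- by rewrite big_map; apply: eq_bigl => u; apply/mem_set; rewrite /= mulVKg.
- by rewrite map_inj_uniq// => u v [].
- by move=> p /= /mapP[u _ ->] /=; rewrite mulVKg.
- move=> [u v] /= uvw; apply: contraNeq; rewrite mulf_eq0 negb_or => /andP[fu gv].
  apply/mapP; exists u; last by rewrite -uvw mulKg.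
  by apply: rP; rewrite // -uvw mulKg.
Qed.

Definition csupp (f g : G -> F) w : seq G :=
  fset_set [set u | supp f u /\ supp g (u^-1 * w)%g].

Lemma csuppP a b w u : a u != 0 -> b (u^-1 * w)%g != 0 -> u \in csupp a b w.
Proof.
move=> au bu; rewrite in_fset_set; first exact/mem_set.
by apply: finite_convolution; exact: supp_wo.
Qed.

Lemma csupp_uniq f g w : uniq (csupp f g w). Proof. exact: fset_uniq. Qed.

Lemma cauchy_supp a b : supp (cauchy a b) `<=` mulset (supp a) (supp b).
Proof.
move=> w; rewrite /supp/= (cauchyE (csupp_uniq a b w)); last exact: csuppP.
apply: contra_neqP => nw; rewrite big1// => u _; apply/eqP.
rewrite mulf_eq0; apply: contra_notT nw; rewrite negb_or => /andP[au bu].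
by exists u, (u^-1 * w)%g; rewrite mulVKg.
Qed.

Lemma mn_mul_wo a b : wo_chain <=%O [pred w | cauchy a b w != 0].
Proof.
apply: (mk_wo (mulset_wo (supp_wo a) (supp_wo b)) (f := cauchy a b)).
exact: cauchy_supp.
Qed.
Arguments mn_mul_wo : clear implicits.
Definition mn_mul a b : series := MNSeries (mn_mul_wo a b).

Definition mn_one : series := mn_mono 1 1%g.

Lemma mn_mulA : associative mn_mul.
Proof.
move=> a b c; apply: mn_ext => w /=.
pose bc := mn_mul b c; pose ab := mn_mul a b.
have fR : finite_set [set u | supp a u /\ mulset (supp b) (supp c) (u^-1 * w)%g].
  by apply: finite_convolution; [|apply: mulset_wo]; exact: supp_wo.
have fT : finite_set [set u | mulset (supp a) (supp b) u /\ supp c (u^-1 * w)%g].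
  by apply: finite_convolution; [apply: mulset_wo|]; exact: supp_wo.
set R := [set u | _] in fR; set T := [set u | _] in fT.
rewrite (cauchyE (r := fset_set R)) ?fset_uniq//; last first.
  by move=> u au bcu; rewrite in_fset_set//; apply/mem_set; split=> //;
     apply: cauchy_supp.
rewrite (cauchyE (r := fset_set T)) ?fset_uniq//; last first.
  by move=> u abu cu; rewrite in_fset_set//; apply/mem_set; split=> //;
     apply: cauchy_supp.
transitivity (\sum_(u <- fset_set R) \sum_(t <- fset_set T)
    a u * (b (u^-1 * t)%g * c (t^-1 * w)%g)).
  apply: eq_big_seq => u _; have [->|au] := eqVneq (a u) 0.
    by rewrite mul0r big1// => t _; rewrite mul0r.
  rewrite (cauchyE (r := [seq u^-1 * t | t <- fset_set T]%g)).
  - rewrite big_map mulr_sumr; apply: eq_bigr => t _.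
    by rewrite invgM invgK -mulgA mulVKg.
  - by rewrite map_inj_uniq ?fset_uniq//; exact: can_inj (mulVKg u).
  - move=> v bv cv; apply/mapP; exists (u * v)%g; last by rewrite mulKg.
    rewrite in_fset_set//; apply/mem_set; split; first by exists u, v.
    by rewrite invgM -mulgA.
rewrite exchange_big /=; apply: eq_big_seq => t.
rewrite in_fset_set// => /set_mem[_ ct].
rewrite (cauchyE (r := fset_set R)) ?fset_uniq//.
  by rewrite mulr_suml; apply: eq_bigr => u _; rewrite mulrA.
move=> u au bu; rewrite in_fset_set//; apply/mem_set; split=> //.
by exists (u^-1 * t)%g, (t^-1 * w)%g; split=> //; rewrite -mulgA mulVKg.
Qed.

Lemma mn_mul1l : left_id mn_one mn_mul.
Proof.
move=> a; apply: mn_ext => w /=; rewrite (cauchyE (r := [:: 1%g]))//=.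
  by rewrite big_seq1 eqxx mul1r invg1 mul1g.
by move=> u; case: ifPn => [/eqP-> _ _|]; rewrite ?mem_head// eqxx.
Qed.

Lemma mn_mul1r : right_id mn_one mn_mul.
Proof.
move=> a; apply: mn_ext => w /=; rewrite (cauchyE (r := [:: w]))//=.
  by rewrite big_seq1 mulVg eqxx mulr1.
move=> u _; case: ifPn => [/eqP uw _|]; last by rewrite eqxx.
by rewrite inE -(mulVKg u w) uw mulg1.
Qed.

Lemma mn_mulDl : left_distributive mn_mul mn_add.
Proof.
move=> a b c; apply: mn_ext => w /=.
pose r := undup (csupp a c w ++ csupp b c w).
have rP u : (u \in csupp a c w) || (u \in csupp b c w) -> u \in r.
  by rewrite mem_undup mem_cat.
rewrite !(cauchyE (r := r)) ?undup_uniq//.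
- by rewrite -big_split; apply: eq_bigr => u _; rewrite /= mulrDl.
- by move=> u bu cu; apply: rP; rewrite (csuppP bu) ?orbT.
- by move=> u au cu; apply: rP; rewrite (csuppP au).
- move=> u /= abu cu; apply: rP; have [au|au] := eqVneq (a u) 0.
    by rewrite au add0r in abu; rewrite (csuppP abu) ?orbT.
  by rewrite (csuppP au).
Qed.

Lemma mn_mulDr : right_distributive mn_mul mn_add.
Proof.
move=> a b c; apply: mn_ext => w /=.
pose r := undup (csupp a b w ++ csupp a c w).
have rP u : (u \in csupp a b w) || (u \in csupp a c w) -> u \in r.
  by rewrite mem_undup mem_cat.
rewrite !(cauchyE (r := r)) ?undup_uniq//.
- by rewrite -big_split; apply: eq_bigr => u _; rewrite /= mulrDr.
- by move=> u au cu; apply: rP; rewrite [in X in _ || X](csuppP au) ?orbT.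
- by move=> u au bu; apply: rP; rewrite (csuppP au).
- move=> u au /= bcu; apply: rP; have [bu|bu] := eqVneq (b (u^-1 * w)%g) 0.
    by rewrite bu add0r in bcu; rewrite [in X in _ || X](csuppP au) ?orbT.
  by rewrite (csuppP au).
Qed.

Lemma mn_one_neq0 : mn_one != 0 :> series.
Proof.
apply/eqP => /(congr1 (fun a : series => a 1%g)) /= /eqP.
by rewrite eqxx oner_eq0.
Qed.

HB.instance Definition _ := GRing.Zmodule_isNzRing.Build series
  mn_mulA mn_mul1l mn_mul1r mn_mulDl mn_mulDr mn_one_neq0.

Definition mn_invertible a := exists b, b * a = 1 /\ a * b = 1.
Definition mn_unit : pred series := fun a => `[< mn_invertible a >].

(* By Malcev and Neumann the units are exactly the nonzero series; on them
   a^-1 is the inverse in the skew-field, and 0^-1 = 0. *)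
Definition mn_inv a : series :=
  if pselect (mn_invertible a) is left e then sval (cid e) else a.

Lemma mn_mulVr : {in mn_unit, left_inverse 1 mn_inv *%R}.
Proof.
move=> a /asboolP ua; rewrite /mn_inv; case: pselect => // e.
by case: cid => b [].
Qed.
Lemma mn_mulrV : {in mn_unit, right_inverse 1 mn_inv *%R}.
Proof.
move=> a /asboolP ua; rewrite /mn_inv; case: pselect => // e.
by case: cid => b [].
Qed.
Lemma mn_unitP a b : b * a = 1 /\ a * b = 1 -> mn_unit a.
Proof. by move=> ab; apply/asboolP; exists b. Qed.
Lemma mn_inv_out : {in [predC mn_unit], mn_inv =1 id}.
Proof. by move=> a /asboolP ua; rewrite /mn_inv; case: pselect. Qed.

HB.instance Definition _ := GRing.NzRing_hasMulInverse.Build series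
  mn_mulVr mn_mulrV mn_unitP mn_inv_out.

End Series.
Arguments supp_wo {F d G} a.
Arguments mn_mono {F d G} c w.

Section CoefMap.
Variables (F : fieldType) (d : Order.disp_t) (G : orderedGroupType d).
Variable f : {rmorphism F -> F}.
Implicit Types (a b : mnseries F G).

Lemma mn_map_supp a : supp (fun w => f (a w)) `<=` supp a.
Proof. by move=> w; rewrite /supp/= fmorph_eq0. Qed.

Lemma mn_map_wo a : wo_chain <=%O [pred w | f (a w) != 0].
Proof.
by apply/wo_chainP; apply: sub_wo (supp_wo a); exact: mn_map_supp.
Qed.
Arguments mn_map_wo : clear implicits.

Definition mn_map a : mnseries F G := MNSeries (mn_map_wo a).

Lemma mn_map_zmod : zmod_morphism mn_map.
Proof. by move=> a b; apply: mn_ext => w /=; rewrite rmorphB. Qed.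

Lemma mn_map_monoid : GRing.monoid_morphism mn_map.
Proof.
split=> [|a b]; apply: mn_ext => w /=; first by case: eqP; rewrite ?rmorph1 ?rmorph0.
rewrite !(cauchyE (csupp_uniq a b w)); first last.
- exact: csuppP.
- by move=> u; rewrite !fmorph_eq0; exact: csuppP.
by rewrite rmorph_sum; apply: eq_bigr => u _; rewrite rmorphM.
Qed.

HB.instance Definition _ := GRing.isZmodMorphism.Build _ _ mn_map mn_map_zmod.
HB.instance Definition _ :=
  GRing.isMonoidMorphism.Build _ _ mn_map mn_map_monoid.

End CoefMap.

Section FreeSkewField.
Variables (F : fieldType) (d : Order.disp_t) (G : orderedGroupType d).
Variable n : nat.
Local Notation series := (mnseries F G).
Implicit Types (K : set F) (x : 'I_n -> G) (S : set series).

Definition coefs_in K : set series := [set a | forall w, K (a w)].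

(* K<x_1, ..., x_n> inside K((G)): finite K-combinations of words in the x_i. *)
Definition free_algebra K x : set series :=
  [set a | [/\ coefs_in K a, finite_set (supp a) &
      forall w, a w != 0 -> exists s : seq 'I_n, w = (\prod_(i <- s) x i)%g]].

Definition inv_closed_subring S : Prop :=
  subring_closed [in S] /\ (forall a, S a -> a != 0 -> S a^-1).

(* The rational closure of K<x_1, ..., x_n> in K((G)). *)
Definition free_skew_field K x : set series :=
  smallest [set S | S `<=` coefs_in K /\ inv_closed_subring S]
    (free_algebra K x).

Definition fsf_pred x : {pred series} := [in free_skew_field setT x].

Lemma fsf_predP x a : reflect (free_skew_field setT x a) (a \in fsf_pred x).
Proof. by apply: (iffP idP) => [/set_mem|/mem_set]. Qed.

Lemma fsf_divring x : divring_closed (fsf_pred x).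
Proof.
split=> [|a b /fsf_predP aS /fsf_predP bS|a b /fsf_predP aS /fsf_predP bS];
    apply/fsf_predP => S [[ST SC] FS].
- by case: SC => -[/set_mem].
- have [[_ SB _] _] := SC; apply/set_mem/SB; apply/mem_set.
    exact: aS.
  exact: bS.
- have [[_ _ SM] SV] := SC; apply/set_mem/SM; apply/mem_set; first exact: aS.
  have Sb : S b by exact: bS.
  by have [b0|] := eqVneq b 0; [rewrite b0 invr0 -b0 | exact: SV].
Qed.

HB.instance Definition _ x :=
  GRing.isDivringClosed.Build series (fsf_pred x) (fsf_divring x).

(* free_skew_field setT x, the free skew-field over F, as a ring in its own
   right, so that group actions on it can be stated intrinsically. *)
Record fsf x := FSF { fsf_val :> series; _ : fsf_val \in fsf_pred x }.

HB.instance Definition _ x := [isSub of fsf x for @fsf_val x].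
HB.instance Definition _ x := [Choice of fsf x by <:].
HB.instance Definition _ x := [SubChoice_isSubUnitRing of fsf x by <:].

Lemma mn_map_fsf x (f : {rmorphism F -> F}) (a : series) :
  a \in fsf_pred x -> mn_map f a \in fsf_pred x.
Proof.
move=> /fsf_predP aS; apply/fsf_predP => S [[ST [[S1 SB SM] SV]] FS].
have : (mn_map f @^-1` S) a; last by [].
apply: aS; split; first split=> //; first split; first split.
- by apply/mem_set; rewrite /= rmorph1; exact/set_mem.
- move=> b c /set_mem/= Sb /set_mem/= Sc; apply/mem_set => /=; rewrite rmorphB.
  by apply/set_mem/SB; exact/mem_set.
- move=> b c /set_mem/= Sb /set_mem/= Sc; apply/mem_set => /=; rewrite rmorphM.
  by apply/set_mem/SM; exact/mem_set.
- move=> b /= Sb b0; have [ub|nub] := boolP (b \is a GRing.unit).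
    rewrite rmorphV//; apply: SV => //; apply/eqP => fb0.
    by have := rmorph_unit (mn_map f) ub; rewrite fb0 unitr0.
  by rewrite invr_out.
- move=> b [bT fb bx]; apply: FS; split=> //.
    by apply: sub_finite_set fb; exact: mn_map_supp.
  by move=> w /=; rewrite fmorph_eq0; exact: bx.
Qed.

Definition fsf_map x (f : {rmorphism F -> F}) (a : fsf x) : fsf x :=
  FSF (mn_map_fsf f (valP a)).

Lemma fsf_map_zmod x f : zmod_morphism (@fsf_map x f).
Proof. by move=> a b; apply: val_inj; rewrite /= rmorphB. Qed.
Lemma fsf_map_monoid x f : GRing.monoid_morphism (@fsf_map x f).
Proof. by split=> [|a b]; apply: val_inj; rewrite /= ?rmorph1 ?rmorphM. Qed.

HB.instance Definition _ x f :=
  GRing.isZmodMorphism.Build _ _ (@fsf_map x f) (@fsf_map_zmod x f).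
HB.instance Definition _ x f :=
  GRing.isMonoidMorphism.Build _ _ (@fsf_map x f) (@fsf_map_monoid x f).

End FreeSkewField.

Definition is_action (G : groupType) T (act : G -> T -> T) : Prop :=
  (forall t, act 1%g t = t) /\
  (forall g h t, act (g * h)%g t = act g (act h t)).

Definition fixed_points (G : Type) T (act : G -> T -> T) : set T :=
  [set t | forall g, act g t = t].

(* tau restricts to act on the constants and is trivial on the elements of Gam. *)
Definition given_by (F : fieldType) d (Gam : orderedGroupType d) n
    (x : 'I_n -> Gam) (G : groupType) (act : G -> F -> F)
    (tau : G -> fsf F x -> fsf F x) : Prop :=
  (forall g (c : F) (a : fsf F x),
     val a = mn_mono c 1%g -> val (tau g a) = mn_mono (act g c) 1%g) /\
  (forall g (w : Gam) (a : fsf F x), val a = mn_mono 1 w -> tau g a = a).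

(* The coefficientwise action on F(<x_1, ..., x_n>) is one such action. *)
Lemma fsf_map_given_by (F : fieldType) d (Gam : orderedGroupType d) n
    (x : 'I_n -> Gam) (G : groupType) (act : G -> {rmorphism F -> F}) :
  is_action (fun g => act g : F -> F) ->
  is_action (fun g => @fsf_map F d Gam n x (act g)) /\
  given_by act (fun g => @fsf_map F d Gam n x (act g)).
Proof.
move=> [act1 actM]; split; split.
- by move=> a; apply: val_inj; apply: mn_ext => w; exact: act1.
- by move=> g h a; apply: val_inj; apply: mn_ext => w; exact: actM.
- move=> g c a aE; rewrite /= -[fsf_val a]/(val a) aE.
  by apply: mn_ext => w /=; case: ifP; rewrite ?rmorph0.
- move=> g w a aE; apply: val_inj; rewrite /= -[fsf_val a]/(val a) aE.
  by apply: mn_ext => v /=; case: ifP; rewrite ?rmorph0 ?rmorph1.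
Qed.

(* Main.v *)
Require Import Defs.
From mathcomp Require Import finmap.
From mathcomp Require Import all_boot all_order all_algebra.
From mathcomp Require Import all_classical.
Set Implicit Arguments.
Unset Strict Implicit.
Unset Printing Implicit Defensive.
Import Order.TTheory GRing.Theory.
Local Open Scope classical_set_scope.
Local Open Scope ring_scope.

(* Write D_K for K(<x>).  By Malcev and Neumann every nonzero series is
   invertible, and the inverse of a series over K has coefficients in K, so D_K
   is a skew-field inside K((Gam)).  For (2), a series of D_F lies in D_L with L
   finitely generated over K, so by induction it suffices to treat L = K(t).
   There t is central, D_K[t] satisfies the Ore condition by Euclid's algorithm,
   so its right fractions form a skew-field containing D_L.  If a in K((Gam))
   equals p q^-1 with p, q in D_K[t], then comparing the coefficients of a q = p
   along a part of 1, t, t^2, ... linearly independent over K expresses a as a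
   quotient of two elements of D_K.  Then (3) follows because a ring morphism on
   D_F is determined by its values on the constants and on Gam, so that the
   action is coefficientwise. *)

(** * Inverses of series *)

Section Neumann.
Variables (d : Order.disp_t) (G : orderedGroupType d) (A : set G).

Definition word_over (s : seq G) : Prop := forall u, u \in s -> A u.

Definition word_products : set G :=
  [set w | exists2 s : seq G, word_over s & w = (\prod_(u <- s) u)%g].

Lemma word_products1 : word_products 1%g.
Proof. by exists [::]; rewrite ?big_nil. Qed.

Lemma word_products_mul u w :
  A u -> word_products w -> word_products (u * w)%g.
Proof.
move=> Au [s sA ->]; exists (u :: s); rewrite ?big_cons// => v.
by rewrite inE => /predU1P[->//|/sA].
Qed.

Hypothesis A_gt1 : forall u, A u -> (1 < u)%g%O.

Lemma word_products_ge1 w : word_products w -> (1 <= w)%g%O.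
Proof.
case=> s sA ->{w}; elim: s sA => [|u s IH] sA; first by rewrite big_nil.
rewrite big_cons; apply: (@le_trans _ _ u).
  by apply/ltW/A_gt1/sA; rewrite mem_head.
rewrite -[X in (X <= _)%O]mulg1 le_mulg2lE; apply: IH => v vs.
by apply: sA; rewrite inE vs orbT.
Qed.

(* Nash-Williams' minimal bad sequence argument; since the order is total, the
   bad sequence can be replaced by the set [V] of those words whose product is
   bad and which are no longer than any bad word with smaller product. *)
Lemma word_products_wo : wo A -> wo word_products.
Proof.
move=> woA; apply: contrapT => nwo.
(* [bad w] amounts to the existence of an infinite decreasing sequence of word products starting at
   or below [w]. *)
pose bad w := ~ wo [set v | word_products v /\ (v <= w)%O].
have nomin_bad C c : C `<=` word_products -> ~ has_min C -> C c -> bad c.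
  move=> CM nC Cc woc; apply: nC.
  have [||m [Cm mc] mP] := woc [set v | C v /\ (v <= c)%O].
  - by move=> v [/CM].
  - by exists c.
  exists m => // w Cw; have [wc|/ltW] := leP w c; first exact: mP.
  exact: le_trans.
have nwoP (B : set G) : ~ wo B -> exists C, [/\ C `<=` B, C !=set0 & ~ has_min C].
  move=> nB; apply: contrapT => nC; apply: nB => C CB C0.
  by apply: contrapT => mC; apply: nC; exists C.
have bad_lt w : bad w -> exists v, [/\ word_products v, (v < w)%O & bad v].
  move=> /nwoP[C [CM [c Cc] nC]].
  have CM' : C `<=` word_products by move=> v /CM[].
  have [[v [Cv vc]]|Cge] := pselect (exists v, C v /\ (v < c)%O); last first.
    case: nC; exists c => // w' Cw'; rewrite leNgt; apply/negP => w'c.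
    by apply: Cge; exists w'.
  exists v; split; [exact: CM'| |exact: nomin_bad Cv].
  by apply: lt_le_trans vc _; have [] := CM _ Cc.
pose pr (s : seq G) := (\prod_(u <- s) u)%g.
pose V := [set s | [/\ word_over s, bad (pr s) & forall s', word_over s' ->
  bad (pr s') -> (pr s' < pr s)%O -> (size s <= size s')%N]].
have badV w : word_products w -> bad w -> exists2 s, V s & (pr s <= w)%O.
  move=> [s0 s0A wE] bw.
  (* A shortest bad word with product at most [w] belongs to [V], since every bad word of smaller
     product competes with it. *)
  pose Q := fun k => `[< exists s, [/\ word_over s, bad (pr s), (pr s <= w)%O &
    size s = k] >].
  have exQ : exists k, Q k.
    by exists (size s0); apply/asboolP; exists s0; rewrite /pr -wE; split.
  case: (ex_minnP exQ) => k /asboolP[s [sA bs sw <-]] kmin.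
  exists s => //; split=> // s' s'A bs' s's; apply/kmin/asboolP.
  by exists s'; split=> //; apply: le_trans sw; exact: ltW.
have V_lt s : V s -> exists2 s', V s' & (pr s' < pr s)%O.
  move=> [sA bs _]; have [v [Mv vs bv]] := bad_lt _ bs.
  by have [s' Vs' s'v] := badV _ Mv bv; exists s' => //; apply: le_lt_trans vs.
have V_cons s : V s -> exists u t, [/\ s = u :: t, A u & word_over t].
  case: s => [|u t] [sA bs _].
    case: bs; apply: sub_wo (@set1_wo _ _ 1%g) => v [/word_products_ge1 v1].
    by rewrite /pr big_nil => v1'; apply/le_anti; rewrite v1 v1'.
  exists u, t; split=> //; first by apply: sA; rewrite mem_head.
  by move=> v vt; apply: sA; rewrite inE vt orbT.
have [s0 Vs0] : V !=set0.
  have [C [CM [c Cc] nC]] := nwoP _ nwo.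
  have [s Vs _] := badV _ (CM _ Cc) (nomin_bad _ _ CM nC Cc).
  by exists s.
(* Here [a] is the least first letter of a word of [V]. *)
have [||a [Aa [t Vat]] amin] := woA [set u | A u /\ exists t, V (u :: t)].
- by move=> u [].
- by have [u [t [sE Au _]]] := V_cons _ Vs0; exists u; split=> //; exists t; rewrite -sE.
have prc u s : pr (u :: s) = (u * pr s)%g by rewrite /pr big_cons.
have tA : word_over t.
  by have [sA _ _] := Vat; move=> v vt; apply: sA; rewrite inE vt orbT.
(* The word [t] is shorter than [a :: t] and has a smaller product, so it cannot be bad. *)
have woT : wo [set v | word_products v /\ (v <= pr t)%O].
  apply: contrapT => bt; have [_ _ /(_ t tA bt)] := Vat.
  by rewrite /= ltnn prc -{1}[pr t]mul1g lt_mulg2rE => /(_ (A_gt1 Aa)).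
(* A word of [V] below [a :: t] starts with a letter at least [a], so its tail has product at most
   [pr t]. The products of such words lie in a well-ordered set and have a least one, which [V_lt]
   contradicts. *)
have [||m [s [Vs sat sm]] mmin] := (mulset_wo woA woT) [set w | exists s,
    [/\ V s, (pr s < pr (a :: t))%O & pr s = w]].
- move=> _ [s [Vs sat <-]]; have [u [t' [sE Au t'A]]] := V_cons _ Vs.
  exists u, (pr t'); split=> //; last by rewrite sE prc.
  split; first by exists t'.
  have au : (a <= u)%O by apply: amin; split=> //; exists t'; rewrite -sE.
  rewrite -(le_mulg2lE a); apply: le_trans (_ : u * pr t' <= _)%g%O.
    by rewrite le_mulg2rE.
  by move: sat; rewrite sE !prc => /ltW.
- by have [s Vs sat] := V_lt _ Vat; exists (pr s), s.
have [s' Vs' s's] := V_lt _ Vs.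
have /mmin : exists s1, [/\ V s1, (pr s1 < pr (a :: t))%O & pr s1 = pr s'].
  by exists s'; split=> //; apply: lt_trans sat.
by rewrite leNgt -sm s's.
Qed.

End Neumann.

Section MalcevNeumann.
Variables (F : fieldType) (d : Order.disp_t) (G : orderedGroupType d).
Implicit Types (a b : mnseries F G) (c : F) (u w : G).

Lemma mn_neq0P a : a != 0 -> exists w, a w != 0.
Proof.
move=> a0; apply: contrapT => na; move/eqP: a0; apply; apply: mn_ext => w /=.
by apply/eqP; apply: contrapT => /negP aw; apply: na; exists w.
Qed.

Lemma mn_lead a : a != 0 -> has_min (supp a).
Proof. by move=> /mn_neq0P[w aw]; apply: (supp_wo a) => //; exists w. Qed.

Lemma mn_oneE w : (1 : mnseries F G) w = (w == 1%g)%:R.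
Proof. by rewrite /=; case: eqP. Qed.

Lemma mn_addE a b w : (a + b) w = a w + b w. Proof. by []. Qed.

Lemma mn_subE a b w : (a - b) w = a w - b w. Proof. by []. Qed.

Lemma mn_monoMl c u a w : (mn_mono c u * a) w = c * a (u^-1 * w)%g.
Proof.
rewrite /= (cauchyE (r := [:: u])) //= ?big_seq1 ?eqxx//.
by move=> v; case: ifPn => [/eqP-> _ _|]; rewrite ?mem_head// eqxx.
Qed.

Lemma mn_monoMr c u a w : (a * mn_mono c u) w = a (w * u^-1)%g * c.
Proof.
rewrite /= (cauchyE (r := [:: w * u^-1]%g)) //=.
  by rewrite big_seq1 invgM invgK mulgVK eqxx.
move=> v _; case: ifPn => [/eqP vw _|]; last by rewrite eqxx.
by rewrite inE -vw invgM invgK mulVKg.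
Qed.

Lemma mn_monoM c c' u u' :
  mn_mono c u * mn_mono c' u' = mn_mono (c * c') (u * u')%g :> mnseries F G.
Proof.
apply: mn_ext => w; rewrite mn_monoMl /=.
rewrite -(inj_eq (mulgI u) _ u') mulVKg.
by case: ifP => // _; rewrite mulr0.
Qed.

(** The solution is the geometric series in [a]. Its coefficients are computed by recursion along
    the well-ordered set [M] of products from [supp a], each from finitely many earlier ones. *)
Lemma mn_fixpoint a : (forall w, a w != 0 -> (1 < w)%g%O) ->
  exists b, b = 1 + a * b.
Proof.
move=> a_gt1; pose M := word_products (supp a).
have woM : wo M by apply: word_products_wo => //; exact: supp_wo.
pose R u w := M u /\ (u < w)%O.
have wfR : well_founded R.
  have accM w : M w -> Acc R w.
    move=> Mw; apply: contrapT => nw.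
    have [||m [Mm nm] mP] := woM [set v | M v /\ ~ Acc R v].
    - by move=> v [].
    - by exists w.
    apply: nm; constructor => v [Mv vm]; apply: contrapT => nv.
    by have := mP _ (conj Mv nv); rewrite leNgt vm.
  by move=> w; constructor => v [/accM].
pose r w : seq G := fset_set [set u | supp a u /\ M (u^-1 * w)%g].
have rP u w : u \in r w <-> supp a u /\ M (u^-1 * w)%g.
  rewrite in_fset_set; last by apply: finite_convolution => //; exact: supp_wo.
  by split=> [/set_mem|/mem_set].
(* For [u] in [r w] the guard on the recursive call holds because [1 < u], so its default 0 is never
   reached. *)
pose step w (rec : forall v, R v w -> F) : F :=
  if `[< M w >] then (w == 1%g)%:R + \sum_(u <- r w) a u *
    (if pselect (R (u^-1 * w)%g w) is left h then rec _ h else 0) else 0.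
pose f := Fix wfR (fun=> F) step.
have fE w : f w = if `[< M w >] then
    (w == 1%g)%:R + \sum_(u <- r w) a u * f (u^-1 * w)%g else 0.
  rewrite /f Fix_eq; last first.
    move=> v g g' gg'; rewrite /step; case: ifP => // _; congr (_ + _).
    by apply: eq_bigr => u _; case: pselect => // h; rewrite gg'.
  rewrite /step; case: ifP => // _; congr (_ + _); apply: eq_big_seq => u.
  move=> /rP[au Mu]; case: pselect => // -[]; split=> //.
  by rewrite -[X in (_ < X)%O]mul1g lt_mulg2rE -(lt_mulg2lE u) mulgV mulg1 a_gt1.
have fM : supp f `<=` M.
  by move=> w; rewrite /supp /= fE; case: asboolP; rewrite ?eqxx.
exists (MNSeries (mk_wo woM fM)); apply: mn_ext => w /=.
(* Off [M] both sides vanish: the product is supported in [supp a] times [M], hence in [M]. *)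
rewrite fE; case: asboolP => Mw; last first.
  rewrite ifN; last by apply/eqP => w1; apply: Mw; rewrite w1; exact: word_products1.
  rewrite add0r; apply/esym/eqP; apply: contrapT => /negP.
  move=> /(cauchy_supp (b := MNSeries (mk_wo woM fM)))[u [v [au fv wE]]].
  by apply: Mw; rewrite wE; apply: word_products_mul => //; exact: (fM _ fv).
rewrite (cauchyE (r := r w)) ?fset_uniq//; last first.
  by move=> u au fu; apply/rP; split=> //; exact: fM.
by congr (_ + _); case: eqP.
Qed.

(** With [z] the inverse of the leading monomial, [z * a] has leading term 1, so [1 - z * a] is
    supported above 1 and [mn_fixpoint] yields a right inverse of [z * a]. *)
Lemma mn_right_inverse a : a != 0 -> exists b, a * b = 1.
Proof.
move=> /mn_lead[u au umin].
pose z : mnseries F G := mn_mono (a u)^-1 u^-1%g.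
have zV : mn_mono (a u) u * z = 1 /\ z * mn_mono (a u) u = 1.
  by rewrite /z !mn_monoM mulfV// mulVf// mulgV mulVg.
have [|b bE] := @mn_fixpoint (1 - z * a).
  move=> w; rewrite mn_subE mn_oneE mn_monoMl invgK => nw.
  have [w1|//|w1] := ltgtP w 1%g; move: nw.
    rewrite lt_eqF// add0r oppr_eq0 mulf_eq0 negb_or => /andP[_ /umin].
    by rewrite -[X in (X <= _)%O]mulg1 le_mulg2lE leNgt w1.
  by rewrite w1 eqxx mulg1 mulVf// subrr eqxx.
exists (b * z).
have zab : z * a * b = 1.
  by move: bE; rewrite mulrBl mul1r addrCA => /eqP; rewrite eq_sym -subr_eq0 addrAC
    subrr add0r subr_eq0 => /eqP.
have ab : a * b = mn_mono (a u) u.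
  by rewrite -[a * b]mul1r -zV.1 -!mulrA [z * _]mulrA zab mulr1.
by rewrite mulrA ab zV.1.
Qed.

(** A right inverse [b] of [a] has a right inverse in turn, which must be [a]; hence [b] is
    two-sided. *)
Lemma mn_unitE a : a != 0 -> a \is a GRing.unit.
Proof.
move=> a0; have [b ab] := mn_right_inverse a0.
have [|c bc] := @mn_right_inverse b.
  by apply/eqP => b0; move/eqP: ab; rewrite b0 mulr0 eq_sym oner_eq0.
apply/unitrP; exists b; split=> //; rewrite -[X in b * X]mulr1 -bc.
by rewrite [a * _]mulrA ab mul1r bc.
Qed.

Lemma mn_mulf_neq0 a b : a != 0 -> b != 0 -> a * b != 0.
Proof.
move=> /mn_unitE ua; apply: contra_neq => ab.
by rewrite -[b](mulKr ua) ab mulr0.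
Qed.

End MalcevNeumann.

(** * Division-closed subrings *)

(** Inversion is the identity on non-units, so the unconditional last clause only constrains
    units. *)
Definition divring_set (R : unitRingType) (S : set R) : Prop :=
  [/\ S 1, forall a b, S a -> S b -> S (a - b),
      forall a b, S a -> S b -> S (a * b) & forall a, S a -> S a^-1].

Section DivringSet.
Variable R : unitRingType.
Implicit Types (S A : set R).

Lemma divring_closed_set S : divring_closed [in S] -> divring_set S.
Proof.
move=> [S1 SB SV].
have SI a : S a -> S a^-1.
  by move=> Sa; apply/set_mem; rewrite -[a^-1]mul1r SV//; exact/mem_set.
split=> [|a b Sa Sb|a b Sa Sb|//]; first exact/set_mem.
  by apply/set_mem/SB; exact/mem_set.
by apply/set_mem; rewrite -[b]invrK SV//; apply/mem_set => //; exact: SI.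
Qed.

Lemma divring_setI S A : divring_set S -> divring_set A -> divring_set (S `&` A).
Proof.
move=> [S1 SB SM SV] [A1 AB AM AV].
split=> // [a b [? ?] [? ?]|a b [? ?] [? ?]|a [? ?]].
- by split; [exact: SB|exact: AB].
- by split; [exact: SM|exact: AM].
- by split; [exact: SV|exact: AV].
Qed.

Lemma smallest_divring_set A : divring_set (smallest (@divring_set R) A).
Proof.
split=> [|a b Sa Sb|a b Sa Sb|a Sa] S SA; have [[S1 SB SM SV] _] := SA => //.
- by apply: SB; [exact: Sa|exact: Sb].
- by apply: SM; [exact: Sa|exact: Sb].
- by apply: SV; exact: Sa.
Qed.

Section Closure.
Variables (S : set R) (dS : divring_set S).

Lemma divring_set0 : S 0.
Proof. by have [S1 SB _ _] := dS; rewrite -(subrr 1); exact: SB. Qed.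

Lemma divring_setN a : S a -> S (- a).
Proof.
by have [_ SB _ _] := dS => Sa; rewrite -sub0r; apply: SB => //; exact: divring_set0.
Qed.

Lemma divring_setD a b : S a -> S b -> S (a + b).
Proof.
have [_ SB _ _] := dS => Sa Sb; rewrite -[b]opprK.
by apply: SB => //; exact: divring_setN.
Qed.

Lemma divring_set_sum (I : Type) (r : seq I) (P : pred I) (f : I -> R) :
  (forall i, P i -> S (f i)) -> S (\sum_(i <- r | P i) f i).
Proof.
by move=> Sf; elim/big_ind: _ => //; [exact: divring_set0|exact: divring_setD].
Qed.

End Closure.
End DivringSet.

Section SeriesSets.
Variables (F : fieldType) (d : Order.disp_t) (G : orderedGroupType d).
Local Notation series := (mnseries F G).
Local Notation C c := (@mn_mono F d G c 1%g).
Implicit Types (a b : series) (c : F) (w : G) (K L : set F) (S : set series).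

Lemma mn_constM c a w : (C c * a) w = c * a w.
Proof. by rewrite mn_monoMl invg1 mul1g. Qed.

Lemma mn_const_comm c a : C c * a = a * C c.
Proof.
by apply: mn_ext => w; rewrite mn_constM mn_monoMr invg1 mulg1 mulrC.
Qed.

Lemma mn_const0 : C 0 = 0.
Proof. by apply: mn_ext => w /=; case: ifP. Qed.

Lemma mn_constB c c' : C (c - c') = C c - C c'.
Proof. by apply: mn_ext => w /=; case: ifP; rewrite ?subr0. Qed.

Lemma mn_constD c c' : C (c + c') = C c + C c'.
Proof. by apply: mn_ext => w /=; case: ifP; rewrite ?addr0. Qed.

Lemma mn_constMM c c' : C (c * c') = C c * C c'.
Proof. by rewrite mn_monoM mulg1. Qed.

Lemma mn_constV c : C c^-1 = (C c)^-1.
Proof.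
have [->|c0] := eqVneq c 0; first by rewrite invr0 mn_const0 invr0.
have uc : C c \is a GRing.unit.
  apply: mn_unitE; apply/eqP => /(congr1 (fun a : series => a 1%g)) /=.
  by rewrite eqxx => /eqP; apply/negP.
by apply: (mulrI uc); rewrite -mn_constMM !mulfV// divrr.
Qed.

Lemma inv_closed_subringP S : inv_closed_subring S <-> divring_set S.
Proof.
split=> [[[S1 SB SM] SV]|[S1 SB SM SV]].
  split=> [|a b Sa Sb|a b Sa Sb|a Sa]; first exact/set_mem.
  - by apply/set_mem/SB; exact/mem_set.
  - by apply/set_mem/SM; exact/mem_set.
  - by have [a0|] := eqVneq a 0; [rewrite a0 invr0 -a0|exact: SV].
split=> [|a Sa _]; last exact: SV.
split=> [|a b /set_mem Sa /set_mem Sb|a b /set_mem Sa /set_mem Sb]; apply/mem_set => //.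
  exact: SB.
exact: SM.
Qed.

(* At the least [w] where a coefficient of [a^-1] leaves [K], the coefficient
   of [a * a^-1] at [u * w], with [u] the order of [a], expresses it in [K]. *)
Lemma coefs_in_divring_set K : divring_set K -> divring_set (coefs_in K : set series).
Proof.
move=> dK; have [K1 KB KM KV] := dK; have K0 := divring_set0 dK.
have K01 (t : bool) : K t%:R by case: t.
have coefsM a b : coefs_in K a -> coefs_in K b -> coefs_in K (a * b).
  move=> Ka Kb w; rewrite /= (cauchyE (csupp_uniq a b w)); last exact: csuppP.
  by apply: divring_set_sum => // u _; exact: KM.
split=> // [w|a b Ka Kb w|a Ka]; first by rewrite mn_oneE.
  exact: KB.
have [->|a0] := eqVneq a 0; first by rewrite invr0.
have ua := mn_unitE a0; apply: contrapT => nV.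
have [w0 nw0] : exists w, ~ K (a^-1 w).
  by apply: contrapT => nw; apply: nV => w; apply: contrapT => nKw; apply: nw; exists w.
have [||w nw wmin] := (supp_wo a^-1) [set w | ~ K (a^-1 w)].
- by move=> w /= nw; apply/eqP => w0'; apply: nw; rewrite w0'.
- by exists w0.
have bw : a^-1 w != 0 by apply/eqP => w0'; apply: nw; rewrite w0'.
have [u au umin] := mn_lead a0.
have := mn_oneE F (u * w)%g; rewrite -(divrr ua) /=.
rewrite (cauchyE (csupp_uniq a (a^-1)%R (u * w)%g)); last exact: csuppP.
rewrite (bigD1_seq u) ?csupp_uniq//=; last by apply: csuppP; rewrite ?mulKg.
rewrite mulKg => /esym/eqP; rewrite -subr_eq => /eqP/esym uw; apply: nw.
rewrite -[a^-1 w](mulKf au) uw; apply: (KM _ _ (KV _ (Ka _))).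
apply: KB => //; apply: divring_set_sum => // v vu.
have [->|av] := eqVneq (a v) 0; first by rewrite mul0r.
(* As [u] is the least element of [supp a], here [u < v], so the other factor is a coefficient of
   [a^-1] below [w] and lies in [K]. *)
apply: KM => //; apply: contrapT => /wmin; rewrite leNgt => /negP; apply.
rewrite mulgA -[X in (_ < X)%O]mul1g lt_mulg2rE -(lt_mulg2lE v) mulVKg mulg1.
by rewrite lt_neqAle eq_sym vu; exact: umin.
Qed.

End SeriesSets.

(** * The rational closure over a subfield and its induction principle *)

Section RationalClosure.
Variables (F : fieldType) (d : Order.disp_t) (G : orderedGroupType d).
Variables (n : nat) (x : 'I_n -> G).
Local Notation series := (mnseries F G).
Local Notation C c := (@mn_mono F d G c 1%g).
Implicit Types (a b : series) (c : F) (w : G) (K L : set F) (S : set series).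
Implicit Type s : seq 'I_n.
Local Notation word s := (\prod_(i <- s) x i)%g.

Lemma finite_supp_sum a : finite_set (supp a) ->
  a = \sum_(w <- fset_set (supp a)) C (a w) * mn_mono 1 w.
Proof.
move=> fa; apply: mn_ext => w.
have sumE (r : seq G) (f : G -> series) : (\sum_(v <- r) f v) w = \sum_(v <- r) f v w.
  by apply: (big_morph (fun a : series => a w)) => // f g; rewrite mn_addE.
rewrite sumE; have [aw|/negPn/eqP aw] := boolP (a w != 0).
  rewrite (bigD1_seq w) ?fset_uniq//; last by rewrite in_fset_set//; exact/mem_set.
  rewrite big1 => [|v vw]; first by rewrite mn_constM /= eqxx mulr1 addr0.
  by rewrite mn_constM /= eq_sym (negPf vw) mulr0.
rewrite big1_seq// => v /andP[_]; rewrite in_fset_set// => /set_mem av.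
by rewrite mn_constM /=; case: eqP => [wv|]; rewrite ?mulr0// -wv aw mul0r.
Qed.

Section Coefficients.
Variables (K : set F) (dK : divring_set K).
Local Notation D := (free_skew_field K x : set series).

(** The sets competing in [free_skew_field] must lie in [coefs_in K]. Intersecting [S] with that
    set, itself division-closed, meets this constraint. *)
Lemma free_skew_field_sub S : divring_set S -> free_algebra K x `<=` S -> D `<=` S.
Proof.
move=> dS KS a; case/(_ (S `&` coefs_in K)) => //; split; last first.
  by move=> b Kb; split; [exact: KS|case: Kb].
split; first by move=> b [].
by apply/inv_closed_subringP/divring_setI => //; exact: coefs_in_divring_set.
Qed.

Lemma free_skew_field_coefs : D `<=` coefs_in K.
Proof.
by apply: free_skew_field_sub; [exact: coefs_in_divring_set|move=> a []].
Qed.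

Lemma free_skew_field_divring : divring_set D.
Proof.
split=> [|a b Da Db|a b Da Db|a Da] S SA;
  have [[_ /inv_closed_subringP[S1 SB SM SV]] _] := SA => //.
- by apply: SB; [exact: Da|exact: Db].
- by apply: SM; [exact: Da|exact: Db].
- by apply: SV; exact: Da.
Qed.

Lemma free_algebra_sub : free_algebra K x `<=` D.
Proof. by move=> a Ka S [_]; exact. Qed.

Lemma mono_free_algebra c s : K c -> free_algebra K x (mn_mono c (word s)).
Proof.
move=> Kc; have K0 := divring_set0 dK; split=> [w /=||w /=]; first by case: ifP.
  apply: sub_finite_set (finite_set1 (word s)) => w; rewrite /supp /=.
  by case: ifPn => [/eqP//|_]; rewrite eqxx.
by case: ifPn => [/eqP-> _|]; [exists s|rewrite eqxx].
Qed.

Lemma free_skew_field_const c : K c -> D (C c).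
Proof.
by move=> Kc; apply: free_algebra_sub; have := mono_free_algebra [::] Kc; rewrite big_nil.
Qed.

Lemma free_skew_field_word s : D (mn_mono 1 (word s)).
Proof. by apply: free_algebra_sub; apply: mono_free_algebra; have [] := dK. Qed.

(** An element of the free algebra is a finite sum of constants times words. *)
Lemma free_skew_field_ind S : divring_set S -> (forall c, K c -> S (C c)) ->
  (forall s, S (mn_mono 1 (word s))) -> D `<=` S.
Proof.
move=> dS SC Sw; apply: free_skew_field_sub => // a [Ka fa ax].
rewrite (finite_supp_sum fa) big_seq; apply: divring_set_sum => // w.
rewrite in_fset_set// => /set_mem/ax[s ->].
by have [_ _ SM _] := dS; apply: SM => //; apply: SC.
Qed.

End Coefficients.

Lemma free_skew_field_mono K L : divring_set K -> divring_set L -> K `<=` L ->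
  free_skew_field K x `<=` free_skew_field L x.
Proof.
move=> dK dL KL; apply: free_skew_field_ind => //.
- exact: free_skew_field_divring.
- by move=> c /KL; exact: free_skew_field_const.
- exact: free_skew_field_word.
Qed.

End RationalClosure.

(** * Descent along a scalar extension *)

Section Descent.
Variables (F : fieldType) (d : Order.disp_t) (G : orderedGroupType d).
Local Notation series := (mnseries F G).
Local Notation C c := (@mn_mono F d G c 1%g).
Implicit Types (a b : series) (c : F) (w : G) (K : set F) (D : set series).
Implicit Type s : seq F.

Fixpoint coef_span K s : set F :=
  if s is c :: s' then [set e | exists k v, [/\ K k, coef_span K s' v & e = c * k + v]]
  else [set 0].

Fixpoint series_span D s : set series :=
  if s is c :: s' then
    [set a | exists b v, [/\ D b, series_span D s' v & a = C c * b + v]]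
  else [set 0].

Lemma coef_spanZ K s c k : divring_set K ->
  coef_span K s c -> K k -> coef_span K s (c * k).
Proof.
move=> [_ _ KM _]; elim: s c => [|e s IH] c /=; first by move->; rewrite mul0r.
move=> [k' [v [Kk' sv ->]]] Kk; exists (k' * k), (v * k).
by split; [exact: KM|exact: IH|rewrite mulrDl mulrA].
Qed.

Lemma coefs_in_series_span K s a w :
  series_span (coefs_in K) s a -> coef_span K s (a w).
Proof.
elim: s a => [|c s IH] a /=; first by move->.
move=> [b [v [Kb sv ->]]]; exists (b w), (v w).
by split; [exact: Kb|exact: IH|rewrite mn_addE mn_constM].
Qed.

Lemma series_span_sub D (D' : set series) s : D `<=` D' ->
  series_span D s `<=` series_span D' s.
Proof.
move=> DD'; elim: s => [|c s IH] //= a [b [v [Db sv ->]]].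
by exists b, v; split; [exact: DD'|exact: IH|].
Qed.

Section Module.
Variables (D : set series) (dD : divring_set D).

Lemma series_spanD s a b :
  series_span D s a -> series_span D s b -> series_span D s (a + b).
Proof.
elim: s a b => [|c s IH] a b /=; first by move=> -> ->; rewrite addr0.
move=> [a' [v [Da sv ->]]] [b' [v' [Db sv' ->]]]; exists (a' + b'), (v + v').
by split; [exact: divring_setD|exact: IH|rewrite mulrDr addrACA].
Qed.

Lemma series_spanN s a : series_span D s a -> series_span D s (- a).
Proof.
elim: s a => [|c s IH] a /=; first by move->; rewrite oppr0.
move=> [b [v [Db sv ->]]]; exists (- b), (- v).
by split; [exact: divring_setN|exact: IH|rewrite mulrN opprD].
Qed.

(** This serves to drop from a list a scalar that the others span over [K]. *)
Lemma series_span_const K s c b : (forall k, K k -> D (C k)) ->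
  coef_span K s c -> D b -> series_span D s (C c * b).
Proof.
move=> KD sc Db; have [_ _ DM _] := dD.
elim: s c sc => [|e s IH] c /=; first by move->; rewrite mn_const0 mul0r.
move=> [k [v [Kk sv ->]]]; exists (C k * b), (C v * b).
split; [by apply: DM => //; exact: KD|exact: IH|].
by rewrite mn_constD mn_constMM mulrDl mulrA.
Qed.

End Module.

(* A scalar [c] outside the [K]-span of [s] is linearly independent of [s] over
   [K((G))], so that its component can be cancelled coefficientwise. *)
Lemma series_span_quotient K D s a p q : divring_set K -> divring_set D ->
  (forall k, K k -> D (C k)) -> D `<=` coefs_in K -> coefs_in K a ->
  series_span D s q -> series_span D s p -> q != 0 -> a * q = p -> D a.
Proof.
move=> dK dD KD DK Ka; have dKs := coefs_in_divring_set G dK.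
have [_ _ KsM _] := dKs.
elim: s p q => [|c s IH] p q /=; first by move=> -> _; rewrite eqxx.
move=> [q0 [q' [Dq0 sq' ->]]] [p0 [p' [Dp0 sp' ->]]] q_neq0 aqp.
(* A dependent [c] is absorbed into the span of [s]; for an independent one, the parts of [a * q]
   and [p] along [c] must agree. *)
have [sc|nsc] := pselect (coef_span K s c).
  apply: IH q_neq0 aqp; apply: series_spanD => //;
  exact: series_span_const sc _.
have spanMl r : series_span D s r -> series_span (coefs_in K) s (a * r).
  elim: s r {IH sq' sp' nsc} => [|e s IH] r /=; first by move->; rewrite mulr0.
  move=> [r0 [r' [Dr0 sr' ->]]]; exists (a * r0), (a * r').
  split; [by apply: KsM => //; exact: DK|exact: IH|].
  by rewrite mulrDr !mulrA mn_const_comm.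
have sub0 : C c * (a * q0 - p0) = p' - a * q'.
  apply/eqP; rewrite mulrBr subr_eq addrAC eq_sym subr_eq [p' + _]addrC -aqp.
  by rewrite mulrDr !mulrA mn_const_comm.
have aq0 : a * q0 = p0.
  apply/eqP; rewrite -subr_eq0; apply/eqP/mn_ext => w.
  (* A nonzero coefficient of [a * q0 - p0] lies in [K], and by [sub0] its product with [c] is in
     the span of [s]; dividing by it would put [c] there. *)
  apply/eqP; apply: contrapT => /negP e0; apply: nsc.
  have Ke : K ((a * q0 - p0) w).
    have [_ KsB _ _] := dKs; apply: KsB; last exact: DK.
    by apply: KsM => //; exact: DK.
  rewrite -[c](mulfK e0); apply: coef_spanZ => //; last by case: dK => _ _ _; apply.
  rewrite -mn_constM sub0; apply: coefs_in_series_span.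
  apply: series_spanD => //; first exact: series_span_sub sp'.
  by apply: series_spanN => //; exact: spanMl.
(* If [q0 = 0] then [p0 = 0] and only [s] remains; otherwise [a = p0 * q0^-1]. *)
have [q00|q00] := eqVneq q0 0.
  move: aqp q_neq0; rewrite -aq0 q00 !mulr0 !add0r => aqp q'0.
  exact: IH q'0 aqp.
have [_ _ DM DV] := dD.
rewrite -[a](mulrK (mn_unitE q00)) aq0; apply: DM => //; exact: DV.
Qed.

End Descent.

(** * Polynomials in one central scalar and their right fractions *)

Section Adjunction.
Variables (F : fieldType) (d : Order.disp_t) (G : orderedGroupType d).
Local Notation series := (mnseries F G).
Local Notation C c := (@mn_mono F d G c 1%g).
Variables (D : set series) (dD : divring_set D) (t : F).
Implicit Types (a b p q u v : series) (N M : nat).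

(* Horner form lets [t] be divided out in [polys_ore], and makes sense also when
   [t] is algebraic over the coefficients. *)
Fixpoint poly_lt N : set series :=
  if N is N'.+1 then [set a | exists b v, [/\ D b, poly_lt N' v & a = b + C t * v]]
  else [set 0].

Definition polys : set series := [set a | exists N, poly_lt N a].

Lemma poly_lt0 N : poly_lt N 0.
Proof.
elim: N => //= N IH; exists 0, 0; rewrite mulr0 addr0.
by split=> //; exact: divring_set0.
Qed.

Lemma poly_ltS N : poly_lt N `<=` poly_lt N.+1.
Proof.
elim: N => [|N IH] a; first by move=> ->; exact: poly_lt0.
by case=> b [v [Db Nv ->]]; exists b, v; split=> //; exact: IH.
Qed.

Lemma poly_lt_le N M : (N <= M)%N -> poly_lt N `<=` poly_lt M.
Proof.
move=> /subnKC<-; elim: (M - N)%N => [|k IH]; first by rewrite addn0.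
by rewrite addnS => a /IH; exact: poly_ltS.
Qed.

Lemma poly_ltB N a b : poly_lt N a -> poly_lt N b -> poly_lt N (a - b).
Proof.
have [_ DB _ _] := dD.
elim: N a b => [|N IH] a b /=; first by move=> -> ->; rewrite subrr.
move=> [a0 [v [Da Nv ->]]] [b0 [v' [Db Nv' ->]]]; exists (a0 - b0), (v - v').
by split; [exact: DB|exact: IH|rewrite mulrBr opprD addrACA].
Qed.

Lemma poly_ltMr N a b : poly_lt N a -> D b -> poly_lt N (a * b).
Proof.
have [_ _ DM _] := dD => + Db.
elim: N a => [|N IH] a /=; first by move=> ->; rewrite mul0r.
move=> [a0 [v [Da Nv ->]]]; exists (a0 * b), (v * b).
by split; [exact: DM|exact: IH|rewrite mulrDl mulrA].
Qed.

Lemma poly_ltX N a : poly_lt N a -> poly_lt N.+1 (C t * a).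
Proof.
by move=> Na; exists 0, a; split=> //; [exact: divring_set0|rewrite add0r].
Qed.

Lemma polys_const : D `<=` polys.
Proof. by move=> b Db; exists 1%N, b, 0; rewrite mulr0 addr0; split. Qed.

Lemma polys1 : polys 1.
Proof. by have [D1 _ _ _] := dD; exact: polys_const. Qed.

Lemma polysB a b : polys a -> polys b -> polys (a - b).
Proof.
move=> [N Na] [M Mb]; exists (maxn N M); apply: poly_ltB.
  exact: poly_lt_le (leq_maxl _ _) _ Na.
exact: poly_lt_le (leq_maxr _ _) _ Mb.
Qed.

Lemma polys0 : polys 0. Proof. by exists 0%N. Qed.

Lemma polysD a b : polys a -> polys b -> polys (a + b).
Proof.
by move=> Ta Tb; rewrite -[b]opprK -[- b]sub0r; apply/polysB/polysB => //; exact: polys0.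
Qed.

Lemma polysX a : polys a -> polys (C t * a).
Proof. by move=> [N /poly_ltX]; exists N.+1. Qed.

Lemma polysM a b : polys a -> polys b -> polys (a * b).
Proof.
move=> Ta [M]; elim: M b => [|M IH] b /=.
  by move=> ->; rewrite mulr0; exact: polys0.
move=> [b0 [v [Db /IH Mv ->]]]; rewrite mulrDr mulrA -mn_const_comm -mulrA.
apply: polysD; last exact: polysX.
by have [N Na] := Ta; exists N; exact: poly_ltMr.
Qed.

Let neq0_mul a b : a * b != 0 -> a != 0 /\ b != 0.
Proof.
by move=> ab; split; apply: contra_neq ab => ->; rewrite ?mul0r ?mulr0.
Qed.

(* Euclid's algorithm on the constant terms, which terminates because [t] can
   be divided out. *)
Lemma polys_ore p q : polys p -> polys q -> p != 0 -> q != 0 ->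
  exists u v, [/\ polys u, polys v, p * u = q * v & p * u != 0].
Proof.
move=> [N Np] [M Mq]; have [k] := ubnP (N + M)%N.
have [_ _ DM DV] := dD.
elim: k => // k IH in N M p q Np Mq *.
wlog MN : N M p q Np Mq / (M <= N)%N.
  move=> wlg NM p0 q0; have [MN|/ltnW NM'] := leqP M N; first exact: (wlg N M).
  rewrite addnC in NM; have [u [v [Tu Tv pq qu]]] := wlg M N q p Mq Np NM' NM q0 p0.
  by exists v, u; rewrite -pq; split.
case: M Mq MN => [|M]; first by move=> -> _ _ _; rewrite eqxx.
case: N Np => // N [p0 [p' [Dp0 Np' pE]]] [q0 [q' [Dq0 Mq' qE]]] MN.
rewrite addSn addnS !ltnS => NMk p_neq0 q_neq0.
have t0 r : C t * r != 0 -> r != 0 by move=> /neq0_mul[].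
(* If [q = C t * q'], a solution for [p] and [q'] becomes one for [p] and [q] on multiplying [u] by
   the central [C t]. *)
have [q00|q00] := eqVneq q0 0.
  have q'0 : q' != 0 by apply: t0; move: q_neq0; rewrite qE q00 add0r.
  have [||||//|u [v [Tu Tv pu pu0]]] := IH N.+1 M p q' => //.
  - by exists p0, p'.
  exists (C t * u), v; split=> //; first exact: polysX.
  - by rewrite qE q00 add0r mulrA -mn_const_comm -!mulrA pu.
  - rewrite mulrA -mn_const_comm -mulrA; apply: mn_mulf_neq0 => //.
    by move: q_neq0; rewrite qE q00 add0r => /neq0_mul[].
(* This [s] cancels the constant term: [p - q * s] is [C t * r], with a smaller length bound for [r]
   than for [p]. *)
pose s := q0^-1 * p0; have Ds : D s by apply: DM => //; exact: DV.
pose r := p' - q' * s.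
have Nr : poly_lt N r.
  by apply: poly_ltB => //; apply: poly_ltMr => //; exact: poly_lt_le Mq'.
have rE : C t * r = p - q * s.
  rewrite /r pE qE mulrBr mulrDl /s [q0 * _]mulVKr ?mn_unitE// opprD.
  by rewrite addrACA subrr add0r !mulrA.
have [tr0|tr_neq0] := eqVneq (C t * r) 0.
  have ps : p = q * s by apply/eqP; rewrite -subr_eq0 -rE tr0.
  by exists 1, s; rewrite mulr1 -ps; split=> //; [exact: polys1|exact: polys_const].
have [|||||u [v [Tu Tv ru ru0]]] := IH N M.+1 r q => //.
- by exists q0, q'.
- by rewrite addnS.
- exact: t0.
exists u, (C t * v + s * u); split=> //.
- by apply: polysD; [exact: polysX|apply: polysM => //; exact: polys_const].
- rewrite mulrDr [q * (s * u)]mulrA [q * (_ * v)]mulrA -mn_const_comm -mulrA -ru.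
  by rewrite mulrA rE mulrBl subrK.
- by apply: mn_mulf_neq0 => //; have [] := neq0_mul ru0.
Qed.

(** These are the right fractions [p * q^-1], recorded by a denominator. *)
Definition fractions : set series :=
  [set a | exists q, [/\ polys q, q != 0 & polys (a * q)]].

Lemma polys_fractions : polys `<=` fractions.
Proof.
by move=> a Ta; exists 1; rewrite mulr1 oner_neq0; split=> //; exact: polys1.
Qed.

(** The Ore condition gives a common right denominator for differences. For products it turns
    [b * q * u] into [p * v], where [p] clears the denominator of [a]. *)
Lemma fractions_divring : divring_set fractions.
Proof.
split=> [|a b [p [Tp p0 Tap]] [q [Tq q0 Tbq]]|a b [p [Tp p0 Tap]] [q [Tq q0 Tbq]]|
         a [q [Tq q0 Taq]]].
- exact/polys_fractions/polys1.
- have [u [v [Tu Tv pq pu0]]] := polys_ore Tp Tq p0 q0.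
  exists (p * u); split=> //; first exact: polysM.
  by rewrite mulrBl [X in _ - b * X]pq !mulrA; apply: polysB; exact: polysM.
- have [bq0|bq0] := eqVneq (b * q) 0.
    by exists q; split=> //; rewrite -mulrA bq0 mulr0; exact: polys0.
  have [u [v [Tu Tv bqu bqu0]]] := polys_ore Tbq Tp bq0 p0.
  exists (q * u); split; first exact: polysM.
    by apply: mn_mulf_neq0 => //; have [] := neq0_mul bqu0.
  by rewrite -mulrA [b * _]mulrA bqu mulrA; exact: polysM.
- have [->|a0] := eqVneq a 0.
    by rewrite invr0; exact/polys_fractions/polys0.
  exists (a * q); split=> //; first exact: mn_mulf_neq0.
  by rewrite mulKr// mn_unitE.
Qed.

(** The list is 1, t, ..., t^(N-1). Its entries may be dependent over the coefficient field, a case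
    that [series_span_quotient] covers. *)
Lemma polys_span : forall N, exists s, poly_lt N `<=` series_span D s.
Proof.
elim=> [|N [s Ns]]; first by exists [::].
exists (1 :: map ( *%R t) s) => _ [b [v [Db /Ns sv ->]]].
exists b, (C t * v); split; rewrite ?mul1r//.
elim: s v sv {Ns} => [|c s IH] v /=; first by move=> ->; rewrite mulr0.
move=> [b' [v' [Db' sv' ->]]]; exists b', (C t * v'); split=> //; first exact: IH.
by rewrite mulrDr mn_constMM mulrA.
Qed.

End Adjunction.

(** * Descent to a subfield and rigidity of ring morphisms *)

Section Main.
Variables (F : fieldType) (d : Order.disp_t) (G : orderedGroupType d).
Variables (n : nat) (x : 'I_n -> G).
Local Notation series := (mnseries F G).
Local Notation C c := (@mn_mono F d G c 1%g).
Implicit Types (K L : set F).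

(** The third hypothesis says that [L] is contained in the field K(t). *)
Lemma free_skew_field_adjoin K L t : divring_set K -> divring_set L ->
  (forall M : set F, divring_set M -> K `<=` M -> M t -> L `<=` M) ->
  coefs_in K `&` free_skew_field L x `<=` free_skew_field K x.
Proof.
move=> dK dL Lmin a [Ka].
pose D := free_skew_field K x.
have dD : divring_set D := free_skew_field_divring x K.
have KD k : K k -> D (C k) by exact: free_skew_field_const.
have DT : D `<=` fractions D t.
  by move=> b /(polys_const t); exact: polys_fractions.
have dS := fractions_divring dD t; have [S1 SB SM SV] := dS.
move=> Da; have [||q [[N Nq] q0 [M Maq]]] := free_skew_field_ind dL dS _ _ Da.
(* The scalars [c] for which [C c] is a fraction form a subfield containing [K] and [t], hence
   [L]. *)
- apply: Lmin => [|k /KD/DT//|].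
    split=> // [c e Sc Se|c e Sc Se|c Sc].
    + by rewrite mn_constB; exact: SB.
    + by rewrite mn_constMM; exact: SM.
    + by rewrite mn_constV; exact: SV.
  apply: polys_fractions => //; rewrite -[C t]mulr1; apply: polysX => //.
  exact: polys1.
- by move=> s; apply: DT; exact: free_skew_field_word.
have [s sP] := polys_span D t (maxn N M).
have leN := leq_maxl N M; have leM := leq_maxr N M.
apply: (series_span_quotient (s := s) dK dD KD _ Ka _ _ q0 erefl).
- exact: free_skew_field_coefs.
- by apply: sP; exact: poly_lt_le leN _ Nq.
- by apply: sP; exact: poly_lt_le leM _ Maq.
Qed.

Definition adjoin_seq K (s : seq F) : set F :=
  smallest (@divring_set F) (K `|` [set` s]).

Lemma adjoin_seq_divring K s : divring_set (adjoin_seq K s).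
Proof. exact: smallest_divring_set. Qed.

Lemma adjoin_seq_sub K s s' : {subset s <= s'} -> adjoin_seq K s `<=` adjoin_seq K s'.
Proof.
move=> ss' c sc M [dM MM]; apply: sc; split=> //.
by move=> e [Ke|/ss' s'e]; apply: MM; [left|right].
Qed.

(** The union is directed, two lists being contained in their concatenation, so it is
    division-closed. *)
Lemma free_skew_field_finitely_generated K : divring_set K ->
  free_skew_field setT x `<=`
    \bigcup_(s in setT) free_skew_field (adjoin_seq K s) x.
Proof.
move=> dK; have D s := free_skew_field_divring x (adjoin_seq K s).
have up (s s' : seq F) a : free_skew_field (adjoin_seq K s) x a ->
    {subset s <= s'} -> free_skew_field (adjoin_seq K s') x a.
  move=> + ss'; apply: free_skew_field_mono; try exact: adjoin_seq_divring.
  exact: adjoin_seq_sub.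
have dT : divring_set (@setT F) by [].
apply: free_skew_field_ind => //.
- split=> [|a b [s _ sa] [s' _ s'b]|a b [s _ sa] [s' _ s'b]|a [s _ sa]].
  + by exists [::] => //; have [] := D [::].
  + exists (s ++ s') => //; have [_ DB _ _] := D (s ++ s').
    by apply: DB; [apply: up sa _|apply: up s'b _] => e es; rewrite mem_cat es ?orbT.
  + exists (s ++ s') => //; have [_ _ DM _] := D (s ++ s').
    by apply: DM; [apply: up sa _|apply: up s'b _] => e es; rewrite mem_cat es ?orbT.
  + by exists s => //; have [_ _ _ DV] := D s; exact: DV.
- move=> c _; exists [:: c] => //; apply: free_skew_field_const.
    exact: adjoin_seq_divring.
  by move=> M [_]; apply; right; rewrite /= mem_head.
- by move=> s; exists [::] => //; apply: free_skew_field_word; exact: adjoin_seq_divring.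
Qed.

(** Adjoined generators are removed one at a time: the coefficients of [a] lie in [K], hence in
    every intermediate field, so [free_skew_field_adjoin] applies at each stage. *)
Lemma coefs_in_free_skew_field K : divring_set K ->
  coefs_in K `&` free_skew_field setT x = free_skew_field K x.
Proof.
move=> dK; apply/seteqP; split=> [a [Ka]|a Da]; last first.
  split; first exact: free_skew_field_coefs Da.
  by apply: free_skew_field_mono Da.
move/(free_skew_field_finitely_generated dK) => [s _ sa].
have Ks s' : K `<=` adjoin_seq K s' by move=> c Kc M [_]; apply; left.
elim: s sa => [|t s IH] sa.
  apply: free_skew_field_mono sa => //; first exact: adjoin_seq_divring.
  by move=> c; apply; split=> // e [].
apply: IH; apply: (@free_skew_field_adjoin (adjoin_seq K s) (adjoin_seq K (t :: s)) t).
- exact: adjoin_seq_divring.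
- exact: adjoin_seq_divring.
- move=> M dM sM Mt c; apply; split=> // e [/Ks/sM//|].
  rewrite /= in_cons => /predU1P[->//|es]; apply: sM => M' [_]; apply; right; exact: es.
- by split=> // w; apply: Ks; exact: Ka.
Qed.

Lemma fixed_points_divring (H : groupType) (act : H -> {rmorphism F -> F}) :
  divring_set (fixed_points act).
Proof.
split=> [g|a b fa fb g|a b fa fb g|a fa g].
- exact: rmorph1.
- by rewrite rmorphB fa fb.
- by rewrite rmorphM fa fb.
- by rewrite fmorphV fa.
Qed.

Lemma fsf_map_unique (f : {rmorphism F -> F}) (h : {rmorphism fsf F x -> fsf F x}) :
  (forall (c : F) (a : fsf F x), val a = mn_mono c 1%g ->
     val (h a) = mn_mono (f c) 1%g) ->
  (forall (w : G) (a : fsf F x), val a = mn_mono 1 w -> h a = a) ->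
  h =1 @fsf_map F d G n x f.
Proof.
(* The set where the two morphisms agree is transported to series, where [free_skew_field_ind]
   applies. *)
move=> hC hw a; pose S := [set val b | b in [set b | h b = @fsf_map F d G n x f b]].
have inj b : S (val b) -> h b = fsf_map f b by move=> [b' hb' /val_inj <-].
apply: inj; have /fsf_predP := valP a; move: (val a) => {}a.
have dT : divring_set (@setT F) by [].
have DP (b : series) : free_skew_field setT x b -> b \in fsf_pred x by move/fsf_predP.
apply: (free_skew_field_ind dT); last 2 first.
- move=> c _; exists (FSF (DP _ (free_skew_field_const dT (I : setT c)))) => //=.
  apply: val_inj; rewrite (hC c)//=; apply: mn_ext => w /=.
  by case: ifP; rewrite ?rmorph0.
- move=> s; exists (FSF (DP _ (free_skew_field_word dT s))) => //=.
  rewrite (hw (\prod_(i <- s) x i)%g)//; apply: val_inj; apply: mn_ext => w /=.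
  by case: ifP; rewrite ?rmorph0 ?rmorph1.
split=> [|_ _ [a' ha <-] [b' hb <-]|_ _ [a' ha <-] [b' hb <-]|_ [b hb <-]].
- by exists 1 => //=; rewrite !rmorph1.
- by exists (a' - b') => //=; rewrite !rmorphB ha hb.
- by exists (a' * b') => //=; rewrite !rmorphM ha hb.
have [->|b0] := eqVneq (val b) 0; first by rewrite invr0; exists 0; rewrite //= !rmorph0.
have DV : free_skew_field setT x (val b)^-1.
  have [_ _ _ DV] := free_skew_field_divring x (@setT F).
  by apply: DV; have /fsf_predP := valP b.
(* Both [h c] and [fsf_map f c] invert the common image of [b], so they coincide. *)
pose c : fsf F x := FSF (DP _ DV).
have bc : b * c = 1 by apply: val_inj; rewrite /= divrr// mn_unitE.
have cb : c * b = 1 by apply: val_inj; rewrite /= mulVr// mn_unitE.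
have fbc : fsf_map f b * fsf_map f c = 1 by rewrite -rmorphM bc rmorph1.
have hcb : h c * h b = 1 by rewrite -rmorphM cb rmorph1.
by exists c => //=; rewrite -[h c]mulr1 -fbc mulrA -hb hcb mul1r.
Qed.

End Main.

Theorem proposition3p1 (F : fieldType) (n : nat) (d : Order.disp_t)
    (Gam : orderedGroupType d) (x : 'I_n -> Gam)
    (charF : [pchar F] =i pred0) (freex : freely_generates x) :
  (forall (G : groupType) (act : G -> {rmorphism F -> F}),
     is_action act ->
     fixed_points (fun g (a : mnseries F Gam) => mn_map (act g) a) =
       coefs_in (fixed_points act)) /\
  (forall K : set F, divring_closed [in K] ->
     coefs_in K `&` free_skew_field setT x = free_skew_field K x) /\
  (forall (G : groupType) (act : G -> {rmorphism F -> F})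
       (tau : G -> {rmorphism fsf F x -> fsf F x}),
     is_action act -> is_action tau -> given_by act tau ->
     [set val a | a in fixed_points tau] = free_skew_field (fixed_points act) x).
Proof.
have fixE (G : groupType) (act : G -> {rmorphism F -> F}) (a : mnseries F Gam) :
    (forall g, mn_map (act g) a = a) <-> coefs_in (fixed_points act) a.
  split=> [fa w g|fa g]; last by apply: mn_ext => w; exact: fa.
  by rewrite -[in RHS](fa g).
split; first by move=> G act _; apply/seteqP; split=> a /fixE.
split; first by move=> K /divring_closed_set; exact: coefs_in_free_skew_field.
move=> G act tau _ _ [tauC tauw].
have tauE g : tau g =1 fsf_map (act g).
  by apply: fsf_map_unique => [c a|w a]; [exact: tauC|exact: tauw].
(* Part (2) turns the right-hand side into an intersection, leaving only a condition on
   coefficients. *)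
rewrite -coefs_in_free_skew_field; last exact: fixed_points_divring.
apply/seteqP; split=> [_ [a fa <-]|a [fa /fsf_predP aD]].
  split; last exact/fsf_predP/(valP a).
  by apply/fixE => g; rewrite -[in RHS](fa g) tauE.
exists (FSF aD) => // g; rewrite tauE; apply: val_inj.
by move/fixE: fa; apply.
Qed.
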